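(* Let $\Omega$, $F$, $K$, $e$ be as in the context. Let $p_1,p_2\in\mathbb{N}$ with $p_1\le p_2$ and let $\varepsilon\ge0$. Then (i) $\varepsilon\text{-}\operatorname{wargmin}_x(\mathcal{VP}_{p_1})\subseteq\varepsilon\text{-}\operatorname{wargmin}_x(\mathcal{VP}_{p_2})$; (ii) $\varepsilon\text{-}\operatorname{argmin}_x(\mathcal{VP}_{p_1})\subseteq\varepsilon\text{-}\operatorname{argmin}_x(\mathcal{VP}_{p_2})$.
   Context: $\mathbb{N}=\{1,2,\ldots\}$ and $[p]=\{1,\ldots,p\}$. Setting: $\Omega\subseteq\mathbb{R}^n$ is nonempty and closed; $F:\mathbb{R}^n\rightrightarrows\mathbb{R}^m$ is a set-valued mapping with $\Omega\subseteq \operatorname{dom}F:=\{x: F(x)\neq\emptyset\}$ and $F(x)$ compact for every $x\in\Omega$; $K\subseteq\mathbb{R}^m$ is a closed, convex, pointed ($K\cap(-K)=\{0\}$), solid ($\operatorname{int}K\ne\emptyset$) cone; $e\in\operatorname{int}K$ is fixed. Multiobjective problem $(\mathcal{VP}_p)$, $p\in\mathbb{N}$: minimize $(y^1,\ldots,y^p)\in\mathbb{R}^{mp}$ with respect to the cone $K^p=\prod_{i=1}^pK$ over all feasible $(x,y^1,\ldots,y^p)$, i.e. $x\in\Omega$ and $y^i\in F(x)$ for all $i\in[p]$. For $\varepsilon\ge0$, a feasible $(\bar x,\bar y^1,\ldots,\bar y^p)$ is an $\varepsilon$-weakly minimal solution if there is no feasible $(x,y^1,\ldots,y^p)$ with $\bar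 y^i-\varepsilon e-y^i\in\operatorname{int}K$ for all $i\in[p]$; it is an $\varepsilon$-minimal solution if there is no feasible $(x,y^1,\ldots,y^p)$ with $(\bar y^1-\varepsilon e-y^1,\ldots,\bar y^p-\varepsilon e-y^p)\in K^p\setminus\{0\}$. The sets $\varepsilon\text{-}\operatorname{wargmin}_x(\mathcal{VP}_p)$ and $\varepsilon\text{-}\operatorname{argmin}_x(\mathcal{VP}_p)$ are the projections onto the $x$-component in $\mathbb{R}^n$ of the sets of $\varepsilon$-weakly minimal and $\varepsilon$-minimal solutions of $(\mathcal{VP}_p)$, respectively. *)

(* Defs.v *)
From mathcomp Require Import all_boot all_order all_algebra.
From mathcomp Require Import all_classical all_reals all_analysis.

Set Implicit Arguments.
Unset Strict Implicit.
Unset Printing Implicit Defensive.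

Import Order.TTheory GRing.Theory Num.Theory.
Import numFieldNormedType.Exports.

Local Open Scope classical_set_scope.
Local Open Scope ring_scope.

Section VectorProblem.
Context {R : realType} {n m : nat}.

Definition dom (F : 'rV[R]_n -> set 'rV[R]_m) : set 'rV[R]_n :=
  [set x | F x !=set0].

(* Scaling by 0 is allowed, so a nonempty cone contains the origin. *)
Definition cone (K : set 'rV[R]_m) : Prop :=
  forall (t : R) (v : 'rV[R]_m), 0 <= t -> K v -> K (t *: v).

Definition pointed (K : set 'rV[R]_m) : Prop :=
  K `&` [set - v | v in K] = [set 0].

Definition solid (K : set 'rV[R]_m) : Prop := interior K !=set0.

(* A point of R^(m p) is a family 'I_p -> 'rV[R]_m, with pointwise
   operations; y^1, ..., y^p are indexed from 0 to p - 1. *)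
Definition cone_power (K : set 'rV[R]_m) (p : nat) : set ('I_p -> 'rV[R]_m) :=
  [set z | forall i, K (z i)].

Variables (Omega : set 'rV[R]_n) (F : 'rV[R]_n -> set 'rV[R]_m).

Definition feasible (p : nat) : set ('rV[R]_n * ('I_p -> 'rV[R]_m)) :=
  [set xy | Omega xy.1 /\ forall i, F xy.1 (xy.2 i)].

Variables (K : set 'rV[R]_m) (e : 'rV[R]_m) (eps : R).

Definition weakly_minimal (p : nat) : set ('rV[R]_n * ('I_p -> 'rV[R]_m)) :=
  [set xybar | feasible xybar /\
    ~ exists2 xy, feasible xy &
        forall i, interior K (xybar.2 i - eps *: e - xy.2 i)].

Definition minimal (p : nat) : set ('rV[R]_n * ('I_p -> 'rV[R]_m)) :=
  [set xybar | feasible xybar /\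
    ~ exists2 xy, feasible xy &
        (@cone_power K p `\ 0) (fun i => xybar.2 i - eps *: e - xy.2 i)].

Definition wargmin_x (p : nat) : set 'rV[R]_n := fst @` @weakly_minimal p.

Definition argmin_x (p : nat) : set 'rV[R]_n := fst @` @minimal p.

End VectorProblem.

(* Main.v *)
(* Repeat components of the p1-solution along a surjection s : [p2] -> [p1].
   A point y dominating the repeated solution yields, for any section t of s,
   the point y \o t dominating the original one. For minimality, t has to pass
   through an index j where the difference vector is nonzero. *)
Require Import Defs.
From mathcomp Require Import all_boot all_order all_algebra.
From mathcomp Require Import all_classical all_reals all_analysis.

Set Implicit Arguments.
Unset Strict Implicit.
Unset Printing Implicit Defensive.

Import Order.TTheory GRing.Theory Num.Theory.
Import numFieldNormedType.Exports.

Local Open Scope classical_set_scope.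
Local Open Scope ring_scope.

(** Redirecting [t] at the single index [s j] to the value [j] keeps it a section, because [j] lies
    in the fibre of [s] over [s j]. *)
Lemma section_through (I J : eqType) (s : J -> I) (t : I -> J) :
  cancel t s -> forall j : J, exists2 t', cancel t' s & t' (s j) = j.
Proof.
move=> tK j; exists (fun i => if i == s j then j else t i); last by rewrite eqxx.
by move=> i; case: eqP => [->|_].
Qed.

Section Reindexing.
Variables (R : realType) (n m : nat).
Variables (Omega : set 'rV[R]_n) (F : 'rV[R]_n -> set 'rV[R]_m).
Variables (K : set 'rV[R]_m) (e : 'rV[R]_m) (eps : R).
Variables (p q : nat) (s : 'I_q -> 'I_p) (t : 'I_p -> 'I_q).

(** The map [f] is arbitrary since both directions occur: [s] carries the solution over, sections of
    [s] pull competitors back. *)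
Lemma feasible_comp (r k : nat) (f : 'I_k -> 'I_r)
    (x : 'rV[R]_n) (y : 'I_r -> 'rV[R]_m) :
  feasible Omega F (x, y) -> feasible Omega F (x, y \o f).
Proof. by move=> [Ox Fy]; split=> // i; exact: Fy. Qed.

Hypothesis tK : cancel t s.

Lemma weakly_minimal_comp (x : 'rV[R]_n) (y : 'I_p -> 'rV[R]_m) :
  weakly_minimal Omega F K e eps (x, y) ->
  weakly_minimal Omega F K e eps (x, y \o s).
Proof.
move=> [feas_xy min_xy]; split; first exact: feasible_comp.
move=> [[x' y'] feas_xy' dom]; apply: min_xy.
exists (x', y' \o t); first exact: feasible_comp.
by move=> i; have /= := dom (t i); rewrite tK.
Qed.

Lemma minimal_comp (x : 'rV[R]_n) (y : 'I_p -> 'rV[R]_m) :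
  minimal Omega F K e eps (x, y) -> minimal Omega F K e eps (x, y \o s).
Proof.
move=> [feas_xy min_xy]; split; first exact: feasible_comp.
move=> [[x' y'] feas_xy' [dom nz]]; apply: nz; apply/funext => j.
(* A nonzero component at [j] would yield a competitor against [(x, y)]. *)
apply: contrapT => nz_j; apply: min_xy.
have [t' t'K t'sj] := section_through tK j.
exists (x', y' \o t'); first exact: feasible_comp.
(* The pulled-back difference at [s j] is the given one at [j], hence nonzero. *)
split=> [i|/(congr1 (@^~ (s j)))] /=.
  by have /= := dom (t' i); rewrite t'K.
by rewrite t'sj.
Qed.

End Reindexing.

Theorem proposition3p1 (R : realType) (n m : nat)
  (Omega : set 'rV[R]_n) (F : 'rV[R]_n -> set 'rV[R]_m)
  (K : set 'rV[R]_m) (e : 'rV[R]_m)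
  (Omega_neq0 : Omega !=set0) (Omega_closed : closed Omega)
  (Omega_dom : Omega `<=` dom F)
  (F_compact : forall x, Omega x -> compact (F x))
  (K_closed : closed K)
  (K_convex : convex_set (K : set (convex_lmodType 'rV[R]_m)))
  (K_cone : cone K) (K_pointed : pointed K) (K_solid : solid K)
  (e_int : interior K e)
  (p1 p2 : nat) (p1_gt0 : (0 < p1)%N) (p12 : (p1 <= p2)%N)
  (eps : R) (eps_ge0 : 0 <= eps) :
  wargmin_x Omega F K e eps p1 `<=` wargmin_x Omega F K e eps p2 /\
  argmin_x Omega F K e eps p1 `<=` argmin_x Omega F K e eps p2.
Proof.
(* Identity on indices below [p1]; all others take the default index 0, so the first component of
   [y] is repeated. The inclusion of indices is a section. *)
pose s (j : 'I_p2) : 'I_p1 := insubd (Ordinal p1_gt0) (val j).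
have tK : cancel (widen_ord p12) s by move=> i; exact: valKd.
split=> _ [[x y] min_xy <-]; exists (x, y \o s) => //.
- exact: weakly_minimal_comp tK _ _ min_xy.
- exact: minimal_comp tK _ _ min_xy.
Qed.
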